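(* For every infinite cardinal $\kappa<\mathfrak{c}$ there is a family $\{X_\alpha:\alpha<\kappa\}$ of subsets of $2^{\omega}$, each of cardinality $\mathfrak{c}$, such that $\{S_{\mathcal{A}_{X_\alpha}}:\alpha<\kappa\}$ is an $RK$-antichain, i.e. $S_{\mathcal{A}_{X_\alpha}}\nleq_{RK}S_{\mathcal{A}_{X_\gamma}}$ for all distinct $\alpha,\gamma<\kappa$.
   Context: $2^{<\omega}=\bigcup_{n<\omega}2^n$ is the Cantor tree, a countable set identified with $\omega$ by a fixed bijection. For $x\in 2^{\omega}$, $A_x=\{x|n:n<\omega\}\subseteq 2^{<\omega}$ is the branch of initial segments of $x$; for $X\subseteq 2^{\omega}$, $\mathcal{A}_X=\{A_x:x\in X\}$. $\mathcal{I}(\mathcal{A}_X)$ is the ideal of all $Z\subseteq 2^{<\omega}$ such that $Z\setminus\bigcup\mathcal{A}'$ is finite for some finite $\mathcal{A}'\subseteq\mathcal{A}_X$, and $S_{\mathcal{A}_X}=\{2^{<\omega}\setminus I:I\in\mathcal{I}(\mathcal{A}_X)\}$ is the dual filter. For filters $\mathcal{F},\mathcal{G}$, $\mathcal{F}\leq_{RK}\mathcal{G}$ means there is a surjection $f$ of the underlying countable set onto itself with $f[\mathcal{G}]=\mathcal{F}$, where $f[\mathcal{G}]=\{Z:f^{-1}(Z)\in\mathcal{G}\}$. *)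

(* Defs.v *)
From mathcomp Require Import all_boot.
From mathcomp Require Import boolp classical_sets functions cardinality filter.

Set Implicit Arguments.
Unset Strict Implicit.
Unset Printing Implicit Defensive.

Local Open Scope classical_set_scope.

Definition cantor_space : Type := nat -> bool.

Definition cantor_tree : Type := seq bool.

(* mkseq x n = [:: x 0; ...; x n.-1] is the initial segment x|n. *)
Definition branch (x : cantor_space) : set cantor_tree :=
  [set mkseq x n | n in [set: nat]].

Definition branches (X : set cantor_space) : set (set cantor_tree) :=
  [set branch x | x in X].

Definition ideal_of (T : Type) (A : set (set T)) : set (set T) :=
  [set Z | exists A' : set (set T),
      [/\ A' `<=` A, finite_set A' & finite_set (Z `\` \bigcup_(B in A') B)]].

Definition dual_filter (T : Type) (A : set (set T)) : set_system T :=
  [set ~` I | I in ideal_of A].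

(* fmap f G is [set Z | G (f @^-1` Z)]. *)
Definition RK_le (T : Type) (F G : set_system T) : Prop :=
  exists f : T -> T, set_surj [set: T] [set: T] f /\ fmap f G = F.

(* Main.v *)
Require Import Defs.
From mathcomp Require Import all_boot.
From mathcomp Require Import boolp classical_sets functions cardinality filter.
From mathcomp Require Import wochoice.

Local Open Scope classical_set_scope.
Local Open Scope card_scope.

Set Implicit Arguments.
Unset Strict Implicit.
Unset Printing Implicit Defensive.

(** A reduction f of S_(A_X) to S_(A_Y) forces every x in X to have f^-1(A_x)
almost covered by finitely many branches through Y. Hence f is ruled out by
any of: (a) some x in X with f^-1(A_x) not almost covered by finitely many
branches; (b) x in X and y outside Y with f^-1(A_x) meeting A_y infinitely
often; (c) infinitely many x in X whose f^-1(A_x) are almost covered by one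
common finite set of branches. A transfinite recursion treats the triples
(f, alpha, gamma) one at a time, always choosing points different from all
earlier ones, to realise (a), (b) or (c). If this were impossible at some stage,
each unused x would be determined, up to finitely many possibilities, by a
finite set of used points, so 2^omega would embed in the finite words over the
set of earlier stages. The triples are well-ordered so that this does not
happen. *)

(** * Branches and almost covers by finitely many of them *)

Definition almost_covers (F : set cantor_space) (Z : set cantor_tree) :=
  finite_set (Z `\` \bigcup_(y in F) branch y).

Lemma branch_almost_disjoint (x y : cantor_space) :
  x <> y -> finite_set (branch x `&` branch y).
Proof.
move=> neq_xy.
have [n neq_n] : exists n, x n <> y n.
  by apply: contrapT => /forallNP eq_xy; apply/neq_xy/funext => n; apply: contrapT.
apply: (sub_finite_set _ (finite_image (mkseq x) (finite_II n.+1))).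
move=> _ [[k _ <-] [m _ eq_km]]; exists k => //=.
have eq_mk : m = k by have := congr1 size eq_km; rewrite !size_mkseq.
rewrite leqNgt; apply/negP => lt_nk; apply: neq_n.
have := congr1 (fun s => nth false s n) eq_km.
by rewrite eq_mk !nth_mkseq.
Qed.

Lemma finite_setI_bigcup (B : set cantor_tree) (F : set cantor_space) :
  finite_set F -> (forall y, F y -> finite_set (B `&` branch y)) ->
  finite_set (B `&` \bigcup_(y in F) branch y).
Proof. by move=> finF finB; rewrite setI_bigcupr; apply: bigcup_finite. Qed.

(** Each dropped branch meets [Z] in a finite set and only finitely many are dropped, so the
    uncovered part grows by finitely many nodes. *)
Lemma almost_covers_filter (F Y : set cantor_space) (Z : set cantor_tree) :
  finite_set F -> almost_covers F Z ->
  (forall y, F y -> ~ Y y -> finite_set (Z `&` branch y)) ->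
  almost_covers (F `&` Y) Z.
Proof.
move=> finF covF finY.
have finFY : finite_set (Z `&` \bigcup_(y in F `\` Y) branch y).
  apply: finite_setI_bigcup; first exact: finite_setD.
  by move=> y [Fy nYy]; apply: finY.
apply: (@sub_finite_set _ _ ((Z `\` \bigcup_(y in F) branch y) `|`
  (Z `&` \bigcup_(y in F `\` Y) branch y))); last by rewrite finite_setU; split.
move=> t [Zt nt].
case: (pselect ((\bigcup_(y in F) branch y) t)) => [[y Fy yt]|nFt]; last by left.
right; split => //; exists y => //; split => // Yy.
by apply: nt; exists y.
Qed.

Lemma almost_covers_notin (F : set cantor_space) (Z : set cantor_tree) y :
  finite_set F -> almost_covers F Z -> ~ F y -> finite_set (Z `&` branch y).
Proof.
move=> finF covF nFy.
have finy : finite_set (branch y `&` \bigcup_(z in F) branch z).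
  apply: finite_setI_bigcup => // z Fz; apply: branch_almost_disjoint => eq_yz.
  by apply: nFy; rewrite eq_yz.
apply: (@sub_finite_set _ _ ((Z `\` \bigcup_(z in F) branch z) `|`
  (branch y `&` \bigcup_(z in F) branch z))); last by rewrite finite_setU; split.
move=> t [Zt yt].
by case: (pselect ((\bigcup_(z in F) branch z) t)) => [Ft|nFt]; [right|left].
Qed.

Lemma ideal_branchesP (X : set cantor_space) (Z : set cantor_tree) :
  ideal_of (branches X) Z <->
  exists F, [/\ F `<=` X, finite_set F & almost_covers F Z].
Proof.
split=> [[A [AX finA covA]]|[F [FX finF covF]]].
  (* [g] selects one point of [X] per branch, turning a finite family of branches into a finite set
     of points. *)
  have [B|g gP] := @boolp.choice _ _ (fun B x => branches X B -> X x /\ branch x = B).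
    case: (pselect (branches X B)) => [[x Xx <-]|nB]; first by exists x.
    by exists (fun=> false).
  exists (g @` A); split; first by move=> _ [B /AX/gP[? _] <-].
    exact: finite_image.
  rewrite /almost_covers bigcup_image.
  suff -> : \bigcup_(B in A) branch (g B) = \bigcup_(B in A) B by [].
  by apply: eq_bigcupr => B /AX/gP[].
exists (branch @` F); split; first exact: image_subset.
  exact: finite_image.
by rewrite bigcup_image.
Qed.

Lemma fmap_dual_filterP (f : cantor_tree -> cantor_tree) (X Y : set cantor_space) :
  fmap f (dual_filter (branches Y)) = dual_filter (branches X) ->
  forall Z, ideal_of (branches X) Z <-> ideal_of (branches Y) (f @^-1` Z).
Proof.
have dualE A Z : dual_filter A (~` Z) <-> @ideal_of cantor_tree A Z.
  by split=> [[I AI /setC_inj <-]|AZ] //; exists Z.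
by move=> eqf Z; rewrite -!dualE -eqf.
Qed.

(** * Constraints on a reduction between two dual filters *)

Section Obstructions.
Variables (f : cantor_tree -> cantor_tree) (X Y : set cantor_space).
Hypothesis redf : fmap f (dual_filter (branches Y)) = dual_filter (branches X).

Lemma reduction_cover x : X x ->
  exists F, [/\ F `<=` Y, finite_set F & almost_covers F (f @^-1` branch x)].
Proof.
move=> Xx; apply/ideal_branchesP/(fmap_dual_filterP redf)/ideal_branchesP.
exists [set x]; split; first by move=> _ ->.
  exact: finite_set1.
by rewrite /almost_covers bigcup_set1 setDv.
Qed.

Lemma reduction_finite x y : X x -> ~ Y y ->
  finite_set (f @^-1` branch x `&` branch y).
Proof.
move=> /reduction_cover[F [FY finF covF]] nYy.
by apply: almost_covers_notin covF _ => // /FY.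
Qed.

(* If V is the complement of the branches through F `&` Y, then f @` V lies in
   the dual filter of X, hence contains almost all of all but finitely many
   branches of X; yet it almost misses the branch of every w n. *)
Lemma reduction_no_common_cover (w : nat -> cantor_space) (F : set cantor_space) :
  finite_set F -> injective w -> (forall n, X (w n)) ->
  ~ (forall n, almost_covers F (f @^-1` branch (w n))).
Proof.
move=> finF injw Xw covF.
have covFY n : almost_covers (F `&` Y) (f @^-1` branch (w n)).
  by apply: almost_covers_filter => // y _; apply: reduction_finite.
set V := ~` \bigcup_(y in F `&` Y) branch y.
have /ideal_branchesP[G [GX finG covG]] : ideal_of (branches X) (~` (f @` V)).
  apply/(fmap_dual_filterP redf)/ideal_branchesP.
  exists (F `&` Y); split; [exact: subIsetr|exact: finite_setIl|].
  rewrite /almost_covers; suff -> : f @^-1` (~` (f @` V)) `\`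
    \bigcup_(y in F `&` Y) branch y = set0 by apply: finite_set0.
  by rewrite -subset0 => t [ntV Vt]; apply: ntV; exists t.
have [n nGwn] : exists n, ~ G (w n).
  apply: contrapT => /forallNP Gw; apply: infinite_nat.
  apply: (@sub_finite_set _ _ (w @^-1` G)) => [n _|]; first by apply: contrapT; apply: Gw.
  by apply: finite_preimage => // ? ? _ _; apply: injw.
have fin1 := almost_covers_notin finG covG nGwn.
have fin2 : finite_set (f @` (f @^-1` branch (w n) `&` V)).
  by apply: finite_image; apply: covFY.
have : finite_set (branch (w n)).
  apply: (@sub_finite_set _ _ ((~` (f @` V) `&` branch (w n)) `|`
    f @` (f @^-1` branch (w n) `&` V))); last by rewrite finite_setU.
  move=> t wt; case: (pselect ((f @` V) t)) => [[u Vu ut]|]; last by left.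
  by right; exists u => //; split => //=; rewrite ut.
move=> fin; apply: infinite_nat.
apply: (@sub_finite_set _ _ (mkseq (w n) @^-1` branch (w n))).
  by move=> k _; exists k.
apply: finite_preimage fin => i j _ _ /(congr1 size).
by rewrite !size_mkseq.
Qed.

End Obstructions.

(** * Coding the Cantor space by finite words *)

Definition word_over (S : Type) (A : set S) : pred (seq (S + nat)) :=
  all (fun a => if a is inl s then s \in A else true).

(* Says that A is large: for infinite A, that 2^omega has at most the
   cardinality of A. *)
Definition encodable (S : Type) (A : set S) :=
  exists2 e : cantor_space -> seq (S + nat), injective e & forall x, word_over A (e x).

Lemma encodable_sub (S : Type) (A B : set S) : A `<=` B -> encodable A -> encodable B.
Proof.
move=> AB [e inje eA]; exists e => // x; apply: sub_all (eA x) => -[s|//].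
by rewrite !in_setE => /AB.
Qed.

(** Words in the naturals alone are countable, and the diagonal point [x] refutes an injection [g]
    into the naturals. *)
Lemma not_encodable_set0 (S : Type) : ~ encodable (@set0 S).
Proof.
move=> [e inje e0].
have [g injg] : exists g : cantor_space -> nat, injective g.
  exists (fun x => pickle (map (fun a : S + nat => if a is inr n then n else 0) (e x))).
  move=> x y /(pcan_inj pickleK) eq_map; apply: inje.
  have {}e0 z : e z = map inr (map (fun a : S + nat => if a is inr n then n else 0) (e z)).
    elim: (e z) (e0 z) => [//|[s|n] l IH] /=; first by rewrite in_set0.
    by move=> /IH <-.
  by rewrite e0 eq_map -e0.
pose x : cantor_space := fun n => ~~ `[< exists y, g y = n /\ y n >].
case xn : (x (g x)); last first.
  by move/negbFE: (xn) => /asboolP[y [/injg ->]]; rewrite xn.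
by move/negP: (xn); apply; apply/asboolP; exists x.
Qed.

(** The extra letter is absorbed by shifting the naturals up by one and giving it the freed [0]. *)
Lemma encodable_setU1 (S : Type) (s : S) (A : set S) : encodable (s |` A) -> encodable A.
Proof.
move=> [e inje eA].
pose h (a : S + nat) : S + nat :=
  match a with
  | inl u => if `[< u = s >] then inr 0 else inl u
  | inr n => inr n.+1
  end.
have injh : injective h.
  move=> [u|n] [u'|n'] /=.
  - by case: asboolP => [->|_]; case: asboolP => [->|_] // [->].
  - by case: asboolP.
  - by case: asboolP.
  - by case=> ->.
exists (map h \o e) => [x y /(inj_map injh)/inje //|x].
rewrite /word_over all_map; apply: sub_all (eA x) => -[u|//] /=.
by case: asboolP => //= neq_us; rewrite !in_setE => -[].
Qed.

(* Prefix code: [inl w] becomes 0, |w|, w and [inr n] becomes 1, n. *)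
Definition flatten_words (S : Type) : seq (seq (S + nat) + nat) -> seq (S + nat) :=
  foldr (fun a l => match a with
                    | inl w => inr 0 :: inr (size w) :: w ++ l
                    | inr n => inr 1 :: inr n :: l
                    end) [::].

Lemma flatten_words_inj (S : Type) : injective (@flatten_words S).
Proof.
elim=> [|[w|n] l IH] [|[w'|n'] l'] //=.
  move=> [eq_size eq_cat].
  have eq_w : w = w'.
    have := congr1 (take (size w)) eq_cat.
    by rewrite take_size_cat // eq_size take_size_cat.
  have := congr1 (drop (size w)) eq_cat.
  by rewrite drop_size_cat // eq_size drop_size_cat // eq_w => /IH ->.
by move=> [-> /IH ->].
Qed.

(** Each letter [u] is replaced by the word [c u]; the prefix code keeps the blocks separable. *)
Lemma encodable_inj (S U : Type) (c : U -> seq (S + nat)) (A : set S) (B : set U) :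
  injective c -> (forall u, B u -> word_over A (c u)) -> encodable B -> encodable A.
Proof.
move=> injc cA [e inje eB].
pose h (a : U + nat) : seq (S + nat) + nat :=
  match a with inl u => inl (c u) | inr n => inr n end.
have injh : injective h by move=> [u|n] [u'|n'] //= [] => [/injc|] ->.
exists (fun x => flatten_words (map h (e x))).
  by move=> x y /flatten_words_inj/(inj_map injh)/inje.
move=> x; elim: (e x) (eB x) => [//|[u|n] l IH] /=; last by move=> /IH.
move=> /andP[]; rewrite in_setE => /cA cu /IH IHl.
by rewrite /word_over all_cat; apply/andP.
Qed.

(** * Well-orderings with small initial segments *)

Lemma well_ordering (S : Type) : exists R : S -> S -> Prop,
  [/\ well_founded R, forall x y z, R x y -> R y z -> R x z
    & forall x y, [\/ R x y, x = y | R y x]].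
Proof.
have [R woR] := @well_ordering_principle {classic S}.
pose le (x y : S) : bool := R x y.
have minR (A : set S) : A !=set0 -> exists2 z, A z & forall x, A x -> le z x.
  move=> [a Aa]; have [|z [[]]] := woR [pred x | `[< A x >]].
    by exists a; rewrite inE.
  rewrite inE => Az minz _; exists z => // x Ax.
  by apply: (minz x); rewrite inE.
have leT x y : le x y \/ le y x.
  have [|z [->|->] minz] := minR [set x; y]; first by exists x; left.
  - by left; apply: minz; right.
  - by right; apply: minz; left.
have lexx x : le x x by case: (leT x x).
have anti x y : le x y -> le y x -> x = y.
  move=> xy yx; have [|z [_ uz]] := woR [pred u : S | `[< u = x \/ u = y >]].
    by exists x; rewrite inE; left.
  rewrite -(uz x) ?(uz y) //; split.
  - by rewrite inE; right.
  - by move=> u; rewrite inE => -[]->; [exact: yx|exact: lexx].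
  - by rewrite inE; left.
  - by move=> u; rewrite inE => -[]->; [exact: lexx|exact: xy].
exists (fun x y => le x y /\ x <> y); split.
- move=> x; apply: contrapT => nAx.
  have [|z nAz minz] := minR [set x | ~ Acc (fun x y => le x y /\ x <> y) x].
    by exists x.
  apply: nAz; constructor => y [yz neq_yz]; apply: contrapT => /minz zy.
  by apply: neq_yz; apply: anti.
- move=> x y z [xy neq_xy] [yz neq_yz].
  (* Transitivity comes from the least element of the three points. *)
  have [|m mP minm] := minR [set u | [\/ u = x, u = y | u = z]].
    by exists x; constructor 1.
  have [mx my mz] : [/\ le m x, le m y & le m z].
    by split; apply: minm; [constructor 1|constructor 2|constructor 3].
  case: mP => eq_m; rewrite eq_m in mx my mz.
  + by split=> // eq_xz; apply: neq_xy; apply: anti => //; rewrite eq_xz.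
  + by case: neq_xy; apply: anti.
  + by case: neq_yz; apply: anti.
- move=> x y; case: (pselect (x = y)) => [->|neq]; first by constructor 2.
  by case: (leT x y) => ?; [constructor 1|constructor 3; split=> // /esym].
Qed.

Lemma wf_minimal (S : Type) (R : S -> S -> Prop) (A : set S) :
  well_founded R -> A !=set0 -> exists2 z, A z & forall x, R x z -> ~ A x.
Proof.
move=> wfR [a]; elim/(well_founded_ind wfR): a => a IH Aa.
case: (pselect (exists2 x, R x a & A x)) => [[x /IH]//|noA].
by exists a => // x xa Ax; apply: noA; exists x.
Qed.

(* Either some well-ordering of U works, or let xi be least with an encodable
   set of predecessors: then U embeds in the words over the predecessors of xi,
   which are ordered by their largest letter first. *)
Lemma small_well_ordering (U : Type) (i : U -> cantor_space) : injective i ->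
  exists R : U -> U -> Prop,
    [/\ well_founded R, forall x y, [\/ R x y, x = y | R y x]
      & forall y, ~ encodable [set x | R x y]].
Proof.
move=> inji; have [R [wfR trR totR]] := well_ordering U.
case: (pselect (exists y, encodable [set x | R x y])); last first.
  by move=> /forallNP noR; exists R.
move=> /(wf_minimal wfR)[xi [e inje eR] minxi].
have irrR x : ~ R x x by move: x; apply: (well_founded_ind wfR) => x IH xx; apply: (IH x).
pose c u := e (i u).
have injc : injective c by move=> x y /inje/inji.
pose bounded u y := word_over [set x | ~ R y x] (c u).
(* [x0] bounds the empty word; without it [e] would encode over the empty alphabet. *)
have [x0 x0xi] : exists x0, R x0 xi.
  apply: contrapT => /forallNP no; apply: (@not_encodable_set0 U).
  by exists e => // x; move: (eR x); apply: sub_all => -[s|//]; rewrite in_setE => /no.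
have bounded_ex u : exists2 y, R y xi & bounded u y.
  rewrite /bounded; have : word_over _ (c u) := eR (i u).
  elim: (c u) => [|a l IH] /=; first by exists x0.
  case: a => [s|n] /=; last by move=> /IH.
  move=> /andP[]; rewrite in_setE => sxi /IH[y yxi ybd].
  have [ys|sy] := EM (R y s); last first.
    by exists y => //; apply/andP; split; rewrite ?in_setE.
  exists s => //; apply/andP; split; first by rewrite in_setE; apply: irrR.
  apply: sub_all ybd => -[z|//]; rewrite !in_setE => nyz sz.
  by apply: nyz; apply: trR sz.
have [u|top topP] := @boolp.choice _ _ (fun u y => [/\ R y xi, bounded u y
    & forall z, bounded u z -> ~ R z y]).
  have [y yxi ybd] := bounded_ex u.
  have [|z zbd minz] := @wf_minimal _ R [set y | bounded u y] wfR; first by exists y.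
  exists z; split=> //; last by move=> x xbd /minz.
  by have [zy|->//|/minz] := totR z y; first exact: trR yxi.
exists (fun u v => R (top u) (top v) \/ top u = top v /\ R u v); split.
- suff acc_top y : forall u, top u = y ->
      Acc (fun u v => R (top u) (top v) \/ top u = top v /\ R u v) u.
    by move=> u; apply: acc_top erefl.
  elim/(well_founded_ind wfR): y => y IHy.
  elim/(well_founded_ind wfR) => u IHu top_u; constructor=> v [vu|[eq_vu vu]].
    by apply: (IHy (top v)) => //; rewrite -top_u.
  by apply: IHu; rewrite // eq_vu.
- move=> u v; have [uv|eq_uv|vu] := totR (top u) (top v).
  + by constructor 1; left.
  + have [uv|->|vu] := totR u v.
    * by constructor 1; right.
    * by constructor 2.
    * by constructor 3; right.
  + by constructor 3; left.
(* Words of predecessors of [v] have letters at most [top v], so encodability passes to [top v] with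
   its predecessors, then to the predecessors alone, against the minimality of [xi]. *)
move=> v encv; have [topxi _ _] := topP v.
apply: (minxi (top v)) => //; apply: (@encodable_setU1 _ (top v)).
apply: (encodable_inj injc _ encv) => u uv; have [_ ubd _] := topP u.
apply: sub_all ubd => -[z|//]; rewrite !in_setE => nuz.
have [zv|->|vz] := totR z (top v); [by right|by left|].
by case: nuz; case: uv => [uv|[-> //]]; apply: trR vz.
Qed.

(** * Diagonalisation against one map, then along all stages *)

Lemma finite_enum (A : set cantor_space) : finite_set A ->
  exists g : nat -> cantor_space, forall x, A x -> exists n, g n = x.
Proof.
move=> /(@finite_seqP {classic cantor_space})[s ->].
exists (nth ((fun=> false) : cantor_space) s) => x xs.
by exists (index (x : {classic cantor_space}) s); apply: (nth_index (T := {classic cantor_space})).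
Qed.

(** Letters are read in pairs naming points [d u n], so that words over a set of stages name finite
    sets of used points. *)
Fixpoint word_points (U : Type) (d : U -> nat -> cantor_space)
    (l : seq (U + nat)) : set cantor_space :=
  if l is inl u :: inr n :: l' then d u n |` word_points d l' else set0.

Lemma word_points_surj (U : Type) (P : set U) (d : U -> nat -> cantor_space)
    (F : set cantor_space) :
  finite_set F -> F `<=` \bigcup_(u in P) range (d u) ->
  exists2 l, word_over P l & word_points d l = F.
Proof.
move=> /(@finite_seqP {classic cantor_space})[s ->].
elim: s => [|x s IH] sP; first by exists [::] => //; rewrite set_nil.
have [y ys|l lP lF] := IH; first by apply: sP; rewrite /= inE ys orbT.
have [u Pu [n _ dun]] := sP x (mem_head _ _).
exists (inl u :: inr n :: l); first by rewrite /= mem_set.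
rewrite /= lF dun; apply/seteqP; split=> y /=; rewrite inE.
  by case=> ->; rewrite ?eqxx ?orbT.
by case/orP=> [/eqP|] ys; [left|right].
Qed.

(* The term v 0 serves only as a point to be kept out of Y. *)
Definition diagonalizes (f : cantor_tree -> cantor_tree) (v : nat -> cantor_space) :=
  forall X Y, (forall n, X (v n.+1)) -> ~ Y (v 0) ->
    fmap f (dual_filter (branches Y)) <> dual_filter (branches X).

Lemma diagonal_sequence (U : Type) (P : set U) (d : U -> nat -> cantor_space)
    (f : cantor_tree -> cantor_tree) :
  ~ encodable P ->
  exists v : nat -> cantor_space,
    (forall n, ~ (\bigcup_(u in P) range (d u)) (v n)) /\ diagonalizes f v.
Proof.
set used := \bigcup_(u in P) range (d u) => smallP.
apply: contrapT => /forallNP noV; apply: smallP.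
have cover_ex x : ~ used x ->
    exists2 F, finite_set F & almost_covers F (f @^-1` branch x).
  move=> nx; apply: contrapT => ncov; apply: (noV (fun=> x)).
  split=> // X Y /(_ 0) Xx _ redf.
  have [F [_ finF covF]] := reduction_cover redf Xx.
  by apply: ncov; exists F.
have fin_unused x y : ~ used x -> ~ used y ->
    finite_set (f @^-1` branch x `&` branch y).
  move=> nx ny; apply: contrapT => inf.
  (* Here [y] is the point kept out of [Y], and [x] the one put into [X]. *)
  apply: (noV (fun n => if n is 0 then y else x)); split=> [[|n] //|X Y].
  by move=> /(_ 0) Xx nYy redf; apply/inf/(reduction_finite redf).
have fin_common F : finite_set F -> finite_set
    [set x | ~ used x /\ almost_covers F (f @^-1` branch x)].
  move=> finF; apply: contrapT => /infiniteP/(@pcard_leP _ (nat -> bool))[w].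
  have wP n := (@funS _ _ _ _ w) n I.
  apply: (noV w); split=> [n|X Y Xw _ redf]; first by have [] := wP n.
  have injw : injective w by move=> m n; apply: inj; rewrite in_setE.
  apply: (reduction_no_common_cover redf finF (w := fun n => w n.+1)) => //.
    by move=> m n /injw[].
  by move=> n; have [] := wP n.+1.
have [F|g gP] := @boolp.choice _ _ (fun F (g : nat -> cantor_space) =>
    finite_set F -> forall x, ~ used x ->
    almost_covers F (f @^-1` branch x) -> exists n, g n = x).
  have [/fin_common/finite_enum[g gP]|] := EM (finite_set F); last first.
    by exists (fun _ _ => false).
  by exists g => _ x nx covF; apply: gP.
pose decode (l : seq (U + nat)) : cantor_space :=
  match l with
  | inl u :: inr n :: _ => d u n
  | inr n :: l' => g (word_points d l') n
  | _ => fun=> false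
  end.
have [x|e eP] := @boolp.choice _ _ (fun x l => word_over P l /\ decode l = x).
  have [[u Pu [n _ <-]]|nx] := EM (used x).
    by exists [:: inl u; inr n]; rewrite /= mem_set.
  have [F finF covF] := cover_ex x nx.
  have covFused : almost_covers (F `&` used) (f @^-1` branch x).
    by apply: almost_covers_filter => // y _; apply: fin_unused.
  have finFused : finite_set (F `&` used) by apply: finite_setIl.
  have [n gn] := gP _ finFused x nx covFused.
  have [l lP lF] := word_points_surj finFused (@subIsetr _ F used).
  by exists (inr n :: l); rewrite /= lF.
(* [e] is injective because [decode] inverts it. *)
exists e => [x y exy|x]; last by have [] := eP x.
by have [_ <-] := eP x; have [_ <-] := eP y; rewrite exy.
Qed.

Lemma diagonal_family (U : Type) (i : U -> cantor_space)
    (f : U -> cantor_tree -> cantor_tree) : injective i ->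
  exists d : U -> nat -> cantor_space,
    (forall u v m n, d u m = d v n -> u = v) /\
    (forall u, diagonalizes (f u) (d u)).
Proof.
move=> /small_well_ordering[R [wfR totR smallR]].
pose good u (avoid : set cantor_space) (v : nat -> cantor_space) :=
  (forall n, ~ avoid (v n)) /\ diagonalizes (f u) v.
(* A default value makes [pick] total, so the recursion is defined before good sequences are known
   to exist at every stage. *)
have [p|pick pickP] := @boolp.choice (U * set cantor_space) _
    (fun p v => (exists v, good p.1 p.2 v) -> good p.1 p.2 v).
  by have [[v]|] := EM (exists v, good p.1 p.2 v); [exists v|exists (fun _ _ => false)].
pose step u (rec : forall v, R v u -> nat -> cantor_space) :=
  pick (u, [set x | exists v (vu : R v u) n, rec v vu n = x]).
pose d := Fix wfR (fun=> nat -> cantor_space) step.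
have dE u : d u = pick (u, \bigcup_(v in [set v | R v u]) range (d v)).
  rewrite {1}/d Fix_eq; last first.
    move=> x h h' eq_h; congr step; apply/functional_extensionality_dep => y.
    by apply/functional_extensionality_dep => yx.
  congr (pick (_, _)); apply/seteqP; split=> x.
    by move=> [v [vu [n <-]]]; exists v => //; exists n.
  by move=> [v vu [n _ <-]]; exists v, vu, n.
have dP u : good u (\bigcup_(v in [set v | R v u]) range (d v)) (d u).
  by rewrite dE; apply: (pickP (_, _)); apply: diagonal_sequence; apply: smallR.
exists d; split=> [u v m n eq_d|u]; last by have [] := dP u.
have [uv|//|vu] := totR u v.
  by have [/(_ n)[]] := dP v; exists u => //; exists m.
by have [/(_ m)[]] := dP u; exists v => //; exists n.
Qed.

(* The cardinal kappa is given by a type K of that cardinality. *)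
Theorem theorem6p9 (K : Type) (K_infinite : infinite_set [set: K])
    (K_le_c : [set: K] #<= [set: cantor_space])
    (K_neq_c : [set: K] #!= [set: cantor_space]) :
  exists X : K -> set cantor_space,
    (forall a : K, X a #= [set: cantor_space]) /\
    (forall a g : K, a <> g ->
      ~ RK_le (dual_filter (branches (X a))) (dual_filter (branches (X g)))).
Proof.
have [k kinj] := @pcard_injP _ (nat -> bool) _ K_le_c.
have injk : injective k by move=> a b; apply: kinj; rewrite in_setE.
pose U : Type := (cantor_tree -> cantor_tree) * K * K.
(* The bits record the graph of the map and the two points that [k] assigns to the indices. *)
pose i (u : U) : cantor_space := fun n =>
  match (unpickle n : option (cantor_tree * cantor_tree + (nat + nat))) with
  | Some (inl (s, t)) => u.1.1 s == t
  | Some (inr (inl m)) => k u.1.2 m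
  | Some (inr (inr m)) => k u.2 m
  | None => false
  end.
have inji : injective i.
  move=> [[f a] b] [[f' a'] b'] eq_i; congr (_, _, _).
  - apply/funext => s; apply/esym/eqP.
    have := congr1 (@^~ (pickle (inl (s, f s) : cantor_tree * cantor_tree + (nat + nat)))) eq_i.
    by rewrite /i pickleK /= eqxx => <-.
  - apply: injk; apply/funext => m.
    have := congr1 (@^~ (pickle (inr (inl m) : cantor_tree * cantor_tree + (nat + nat)))) eq_i.
    by rewrite /i pickleK.
  - apply: injk; apply/funext => m.
    have := congr1 (@^~ (pickle (inr (inr m) : cantor_tree * cantor_tree + (nat + nat)))) eq_i.
    by rewrite /i pickleK.
have [d [dinj dP]] := diagonal_family (fun u : U => u.1.1) inji.
exists (fun a => [set x | exists (u : U) n, u.1.2 = a /\ d u n.+1 = x]).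
split=> [a|a b neq_ab [f [_ redf]]].
  rewrite card_eq_le; apply/andP; split; first exact: card_leT.
  (* Each [x] is coded as a map on the tree, giving continuum many stages that feed [X a]; term [1]
     is the first one put into [X a]. *)
  pose h (x : cantor_space) := d (fun s : cantor_tree => [:: x (size s)], a, a) 1.
  have injh : injective h.
    move=> x y /dinj[eq_xy]; apply/funext => n.
    by have := congr1 (@^~ (nseq n false)) eq_xy; rewrite size_nseq => -[].
  have /card_eqPle[_ le_h] := inj_card_eq (A := [set: cantor_space]) (in2W injh).
  apply: card_le_trans le_h _; apply: subset_card_le => _ [x _ <-].
  by exists (fun s : cantor_tree => [:: x (size s)], a, a), 0.
(* Term [0] of stage [(f, a, b)] is outside [X b]: distinct stages share no point, and this stage
   feeds only [X a]. *)
by apply: (dP (f, a, b) _ _ _ _ redf) => [n|[u [n [ub /dinj eq_u]]]];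
  [exists (f, a, b), n|apply: neq_ab; rewrite -ub eq_u].
Qed.
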